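(* Let $q>0$, $\mu=\sqrt q$, $H$ a $d$-dimensional Hilbert space with orthonormal basis $(\psi_r)$, $2\le n\le d$ and $1\le i_1<\dots<i_n\le d$. Set $\overline H_{i_1,\dots,i_n}:=\varepsilon(E_{n-1})H_{i_1,\dots,i_n}^{\otimes(n-1)}$, $R_{i_1,\dots,i_n}:=\frac{1}{\mu^{(n-1)/2}\sqrt{(n-1)!_q}}S_{i_1,\dots,i_n}$ and $\overline R_{i_1,\dots,i_n}:=(-1)^{n-1}R_{i_1,\dots,i_n}$. Then $R_{i_1,\dots,i_n}\in\overline H_{i_1,\dots,i_n}\otimes H_{i_1,\dots,i_n}$, $\overline R_{i_1,\dots,i_n}\in H_{i_1,\dots,i_n}\otimes\overline H_{i_1,\dots,i_n}$, and the conjugate equations hold: $(\overline R_{i_1,\dots,i_n}^*\otimes1_{H_{i_1,\dots,i_n}})(1_{H_{i_1,\dots,i_n}}\otimes R_{i_1,\dots,i_n})=1_{H_{i_1,\dots,i_n}}$, $(R_{i_1,\dots,i_n}^*\otimes1_{\overline H_{i_1,\dots,i_n}})(1_{\overline H_{i_1,\dots,i_n}}\otimes\overline R_{i_1,\dots,i_n})=1_{\overline H_{i_1,\dots,i_n}}$. Hence $\overline H_{i_1,\dots,i_n}$ is a conjugate of $H_{i_1,\dots,i_n}$ in the smallest tensor $*$-category of Hilbert spaces (with subobjects) containing $S_{i_1,\dots,i_n}$.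
   Context: $g_q$ on $H\otimes H$: $g_q\psi_i\otimes\psi_j=-\mu\psi_j\otimes\psi_i$ ($i<j$), $g_q\psi_i\otimes\psi_i=-\psi_i\otimes\psi_i$, $g_q\psi_i\otimes\psi_j=(q-1)\psi_i\otimes\psi_j-\mu\psi_j\otimes\psi_i$ ($i>j$); Jimbo–Woronowicz representation $\varepsilon(g_i)=1_{H^{\otimes(i-1)}}\otimes g_q\otimes1$ of the Hecke algebras $H_m(q)$. $A_1=1$, $A_{m+1}=\sum_{i=0}^mg_i\cdots g_1\sigma(A_m)$, $\sigma(g_i)=g_{i+1}$, $m!_q=\prod_{j=1}^m(1+\dots+q^{j-1})$, $E_m=A_m/m!_q$. $S_{i_1,\dots,i_n}:=\sum_{p\in\mathbb P_n}(-\mu)^{i(p)}\psi_{i_{p(1)}}\otimes\dots\otimes\psi_{i_{p(n)}}$ with $i(p)$ the number of inversions of $p$, viewed as a map $\mathbb C\to H^{\otimes n}$. $H_{i_1,\dots,i_n}=\mathrm{span}\{\psi_{i_1},\dots,\psi_{i_n}\}$. Objects $\sigma,\bar\sigma$ are conjugate if there are $R\in(\iota,\bar\sigma\otimes\sigma)$, $\bar R\in(\iota,\sigma\otimes\bar\sigma)$ satisfying the two conjugate equations above. *)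

(* Defs.v *)
(* Scalars: an arbitrary numeric algebraically closed field C
   (e.g. the complex numbers); H = C^d with orthonormal basis psi_0..psi_{d-1}
   (the paper's psi_1..psi_d, shifted by one).
   A tensor of order m in H^{(x) m} is given by its coordinates in the basis
   psi_{t_1} (x) ... (x) psi_{t_m}, i.e. by a function  seq 'I_d -> C  of which
   only the values on sequences of length m matter. *)
From mathcomp Require Import all_boot all_order all_algebra all_fingroup.
Set Implicit Arguments. Unset Strict Implicit. Unset Printing Implicit Defensive.
Import Order.TTheory GRing.Theory Num.Theory.
Local Open Scope ring_scope.

Section Defs.
Variables (C : numClosedFieldType) (d : nat).

Definition tens := seq 'I_d -> C.

Definition teq (m : nat) (x y : tens) : Prop := forall t : m.-tuple 'I_d, x t = y t.

Definition at_ (t : seq 'I_d) (j : nat) : nat := nth 0%N (map val t) j.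

(* matrix of g_q on H (x) H (parameters q, mu):
   gcoef a b c e = coefficient of psi_a (x) psi_b in g_q (psi_c (x) psi_e). *)
Definition gcoef (q mu : C) (a b c e : nat) : C :=
  if (c < e)%N then (if (a == e) && (b == c) then - mu else 0)
  else if c == e then (if (a == c) && (b == e) then -1 else 0)
  else ((if (a == c) && (b == e) then q - 1 else 0)
        + (if (a == e) && (b == c) then - mu else 0)).

(* epsilon(g_j) = 1_{H^{(x)(j-1)}} (x) g_q (x) 1 on H^{(x) m}, j >= 1:
   g_q acts on the factors j, j+1 (1-based), i.e. positions j-1, j (0-based). *)
Definition eps_g (q mu : C) (m j : nat) (x : tens) : tens :=
  fun t => \sum_(s : m.-tuple 'I_d)
    (if [forall k : 'I_m, ((val k != j.-1) && (val k != j)) ==>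
                          (at_ t k == at_ s k)]
     then gcoef q mu (at_ t j.-1) (at_ t j) (at_ s j.-1) (at_ s j) * x s
     else 0).

(* a word [:: a1; ...; ak] stands for g_{a1} g_{a2} ... g_{ak} *)
Definition word_op (q mu : C) (m : nat) (w : seq nat) (x : tens) : tens :=
  foldr (fun a y => eps_g q mu m a y) x w.

(* A_{k+1} as a formal sum (list) of words in the generators:
   A_1 = 1, A_{m+1} = sum_{i=0}^m g_i ... g_1 sigma(A_m), sigma(g_i) = g_{i+1}. *)
Fixpoint Awords (k : nat) : seq (seq nat) :=
  match k with
  | 0 => [:: [::]]
  | k'.+1 => flatten [seq [seq rev (iota 1 i) ++ map S w | w <- Awords k']
                     | i <- iota 0 k'.+2]
  end.

Definition qfact (q : C) (m : nat) : C :=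
  \prod_(1 <= j < m.+1) \sum_(k < j) q ^+ k.

Definition epsE (q mu : C) (m : nat) (x : tens) : tens :=
  fun t => (qfact q m)^-1 * \sum_(w <- Awords m.-1) word_op q mu m w x t.

Definition inversions (n : nat) (p : 'S_n) : nat :=
  #|[set x : 'I_n * 'I_n | (x.1 < x.2)%N && (p x.2 < p x.1)%N]|.

Definition Svec (mu : C) (n : nat) (i : 'I_n -> 'I_d) : tens :=
  fun t => \sum_(p : 'S_n)
     (- mu) ^+ inversions p * (t == [seq i (p k) | k <- enum 'I_n])%:R.

Definition in_Hi_pow (n : nat) (i : 'I_n -> 'I_d) (m : nat) (x : tens) : Prop :=
  forall t : m.-tuple 'I_d, x t != 0 -> all (fun a => a \in codom i) t.

Definition in_Hbar (q mu : C) (n : nat) (i : 'I_n -> 'I_d) (x : tens) : Prop :=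
  exists y : tens, in_Hi_pow i n.-1 y /\ teq n.-1 x (epsE q mu n.-1 y).

Definition tprod (a : nat) (x y : tens) : tens :=
  fun s => x (take a s) * y (drop a s).

(* (X^* (x) 1) y, with X of order a: contraction of the first a factors *)
Definition contr (a : nat) (X y : tens) : tens :=
  fun u => \sum_(s : a.-tuple 'I_d) (X s)^* * y (s ++ u).

Definition in_tens (a b : nat) (V W : tens -> Prop) (z : tens) : Prop :=
  exists (k : nat) (xs ys : 'I_k -> tens),
    (forall j, V (xs j)) /\ (forall j, W (ys j)) /\
    teq (a + b) z (fun s => \sum_(j < k) tprod a (xs j) (ys j) s).

End Defs.

(* Main.v *)
Require Import Defs.
From mathcomp Require Import all_boot all_order all_algebra all_fingroup.
From mathcomp Require Import ring zify.
Set Implicit Arguments. Unset Strict Implicit. Unset Printing Implicit Defensive.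
Import Order.TTheory GRing.Theory Num.Theory.
Local Open Scope ring_scope.

(* On coordinates, g_q sends [y] to a combination of [y] and of [y] with two adjacent
   entries exchanged.  The Hecke and braid relations give g_j A_m = q A_m, and a tensor
   [y] with g_j y = q y for all j satisfies: [y t / (- mu) ^ inv t] is invariant under
   permutations of [t], and [y t = 0] when [t] has a repeated entry.  Conversely A_m acts
   on such a tensor as the sum of [q ^ length] over its words, which is [m!_q].  So
   [Hbar] is the space of these tensors with entries in the image of [i], and partial
   evaluations of [S] lie in it.  In both conjugate equations only the tuples [s] with
   [b :: s] a permutation of the image of [i], for one fixed [b], contribute; since
   inv (b :: s) + inv (s, b) = 2 inv s + (n - 1), the scalar that remains is
   c^2 mu^(n-1) sum_s q^(inv s) = c^2 mu^(n-1) (n-1)!_q = 1. *)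

(** * Adjacent transpositions of a sequence *)

Fixpoint swp (T : Type) (k : nat) (t : seq T) : seq T :=
  match k, t with
  | 0, a :: b :: u => b :: a :: u
  | k'.+1, a :: u => a :: swp k' u
  | _, _ => t
  end.

Lemma size_swp (T : Type) k (t : seq T) : size (swp k t) = size t.
Proof.
elim: k t => [|k IH] [|a t] //=; first by case: t.
by rewrite IH.
Qed.

Lemma swp_cat (T : Type) k (u v : seq T) :
  (k.+1 < size u)%N -> swp k (u ++ v) = swp k u ++ v.
Proof.
elim: k u => [|k IH] [|a u] //= hk; first by case: u hk.
by rewrite IH.
Qed.

Lemma perm_swp (T : eqType) k (t : seq T) : perm_eq (swp k t) t.
Proof.
elim: k t => [|k IH] [|a t] //=; last by rewrite perm_cons.
by case: t => //= b t; apply/permPl; exact: (perm_catCA [:: b] [:: a] t).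
Qed.

(** Adjacent transpositions generate all permutations. If the heads [a], [b] differ, the induction
    on tails brings [b] to second place in [s], one swap puts it in front, and the tails are
    compared again. *)
Lemma perm_swp_invariant (T : eqType) (V : Type) m (f : seq T -> V) :
  (forall k s, size s = m -> (k.+1 < m)%N -> f (swp k s) = f s) ->
  forall s t, size s = m -> perm_eq s t -> f s = f t.
Proof.
elim: m f => [|m IH] f Hf s t hs st.
  by move: (perm_size st); rewrite hs (size0nil hs) => /esym/size0nil ->.
have IHc a s' t' : size s' = m -> perm_eq s' t' -> f (a :: s') = f (a :: t').
  apply: (IH (fun u => f (a :: u))) => k u hu hk.
  by apply: (Hf k.+1 (a :: u)) => //=; rewrite hu.
case: s hs st => // a s [hs] st.
case: t st => [/perm_size //|b t] st.
have ht : size t = m by move/perm_size: st => /= [<-].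
have [ab|nab] := eqVneq a b.
  by subst b; apply: IHc => //; rewrite perm_cons in st.
have bs : b \in s.
  by move: (perm_mem st b); rewrite !inE eqxx eq_sym (negPf nab).
have sb := perm_to_rem bs.
have hr : (size (rem b s)).+1 = m by rewrite -hs (perm_size sb).
rewrite (IHc a _ _ hs sb) -(Hf 0 [:: a, b & rem b s]) /= ?hr -?hr //.
apply: IHc; first by rewrite -hr.
rewrite -(perm_cons b) -(permPr st) perm_sym.
apply: (perm_trans (y := [:: a, b & rem b s])); first by rewrite perm_cons.
exact: (perm_swp 0 [:: b, a & rem b s]).
Qed.

(** * Inversion numbers of words *)

Section Inversions.
Variable d : nat.
Implicit Types t u : seq 'I_d.

Fixpoint invs t : nat :=
  if t is a :: u then (count (fun b : 'I_d => (b < a)%N) u + invs u)%N else 0%N.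

Lemma at_swp_l k t : (k.+1 < size t)%N -> at_ (swp k t) k = at_ t k.+1.
Proof. by elim: k t => [|k IH] [|a [|b t]] //= hk; apply: IH. Qed.

Lemma at_swp_r k t : (k.+1 < size t)%N -> at_ (swp k t) k.+1 = at_ t k.
Proof. by elim: k t => [|k IH] [|a [|b t]] //= hk; apply: IH. Qed.

Lemma swpK k t : swp k (swp k t) = t.
Proof. by elim: k t => [|k IH] [|a [|b t]] //=; rewrite ?IH. Qed.

Lemma at_cat k t u : (k < size t)%N -> at_ (t ++ u) k = at_ t k.
Proof. by move=> hk; rewrite /at_ map_cat nth_cat size_map hk. Qed.

Lemma invs_swp k t : (k.+1 < size t)%N -> (at_ t k < at_ t k.+1)%N ->
  invs (swp k t) = (invs t).+1.
Proof.
elim: k t => [|k IH] [|a [|b t]] //=; rewrite /at_ /=.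
  by move=> _ ab; rewrite ab ltnNge (ltnW ab) /=; lia.
by move=> hk lt; rewrite IH // (seq.permP (perm_swp k (b :: t))) /= addnS.
Qed.

Lemma swp_fix k t : (k.+1 < size t)%N -> at_ t k = at_ t k.+1 -> swp k t = t.
Proof.
elim: k t => [|k IH] [|a [|b t]] //=; rewrite /at_ /=.
  by move=> _ /val_inj ->.
by move=> hk e; rewrite IH.
Qed.

Lemma at_uniq k t : (k.+1 < size t)%N -> uniq t -> at_ t k != at_ t k.+1.
Proof.
move=> hk ut; rewrite /at_ nth_uniq ?size_map ?(ltnW hk) //.
  by rewrite -(inj_eq (@addIn 1)) neq_ltn addn1 addn1 leqnn.
by rewrite map_inj_uniq //; apply: val_inj.
Qed.

Lemma invs_rcons t b :
  invs (rcons t b) = (invs t + count (fun a : 'I_d => (b < a)%N) t)%N.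
Proof.
elim: t => //= a t IH; rewrite IH -cats1 count_cat /= addn0.
by rewrite -!addnA; congr (_ + _)%N; rewrite addnCA addnA.
Qed.

Lemma count_lt_gt t b : b \notin t ->
  (count (fun a : 'I_d => (a < b)%N) t + count (fun a : 'I_d => (b < a)%N) t)%N
  = size t.
Proof.
move=> bt; rewrite -[RHS](count_predC (fun a : 'I_d => (a < b)%N)).
congr (_ + _)%N; apply: eq_in_count => a at_ /=.
rewrite -leqNgt ltn_neqAle; case: eqP => //= /val_inj ba.
by rewrite ba at_ in bt.
Qed.

End Inversions.

(** * Hecke generators in coordinates: quadratic, commutation and braid relations *)

Section HeckeGenerators.
Variables (C : numClosedFieldType) (d : nat) (q mu : C).
Hypothesis mu2 : mu ^+ 2 = q.
Implicit Types (x y : tens C d) (t u : seq 'I_d).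

(** Row [(a, b)] of g_q: [galpha] weights the exchanged entry, [gbeta] the unchanged one. For
    [a = b] the two entries coincide and [galpha] alone carries the eigenvalue -1. *)
Definition galpha (a b : nat) : C := if a == b then -1 else - mu.
Definition gbeta (a b : nat) : C := if (b < a)%N then q - 1 else 0.

(** Indices are zero-based: [hg k] stands for the generator g_(k+1). No tensor order is fixed, so
    [hg] can be evaluated on tails of a word. *)
Definition hg (k : nat) x : tens C d := fun t =>
  galpha (at_ t k) (at_ t k.+1) * x (swp k t) + gbeta (at_ t k) (at_ t k.+1) * x t.

Lemma hg_cons k x a u : hg k.+1 x (a :: u) = hg k (fun v => x (a :: v)) u.
Proof. by []. Qed.

Lemma hg_hecke k x t : (k.+1 < size t)%N ->
  hg k (hg k x) t = (q - 1) * hg k x t + q * x t.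
Proof.
move=> hk; rewrite /hg swpK at_swp_l // at_swp_r // /galpha /gbeta -mu2.
case: ltngtP => [h|h|h]; rewrite /=; try ring.
by rewrite swp_fix //; ring.
Qed.

Lemma hg_comm k l x t : (k.+1 < l)%N -> (l.+1 < size t)%N ->
  hg k (hg l x) t = hg l (hg k x) t.
Proof.
elim: k l x t => [|k IH] [|l] x [|a t] //= kl lt.
  case: l kl lt => // l _; case: t => // b t lt.
  rewrite /hg /at_ /=; ring.
by rewrite hg_cons; apply: IH.
Qed.

Lemma hg_braid k x t : (k.+2 < size t)%N ->
  hg k (hg k.+1 (hg k x)) t = hg k.+1 (hg k (hg k.+1 x)) t.
Proof.
elim: k x t => [|k IH] x [|a t] //= lt; last exact: (IH (fun v => x (a :: v)) t).
case: t lt => [|b [|c t]] // _.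
rewrite /hg /at_ /= /galpha /gbeta -mu2.
(* Only the order type of the three letters matters. Where two values coincide the letters are
   identified, so that the corresponding evaluations of [x] become the same term. *)
have := @val_inj _ _ _ a b; have := @val_inj _ _ _ b c; have := @val_inj _ _ _ a c.
case: (ltngtP a b) => ab; case: (ltngtP b c) => bc; case: (ltngtP a c) => ac;
  move=> Eac Ebc Eab; try (by exfalso; lia);
  rewrite ?(Eac ac) ?(Ebc bc) ?(Eab ab) /=; ring.
Qed.

End HeckeGenerators.

(** * The operators A_m and the common q-eigenvectors of the generators *)

Section Antisymmetrizer.
Variables (C : numClosedFieldType) (d : nat) (q mu : C).
Hypothesis mu2 : mu ^+ 2 = q.
Implicit Types (x y : tens C d) (t u : seq 'I_d) (w : seq nat).

Notation g := (hg q mu).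

Lemma hg_congr m k x y :
  (forall t, size t = m -> x t = y t) ->
  forall t, size t = m -> g k x t = g k y t.
Proof. by move=> xy t ht; rewrite /hg !xy // size_swp. Qed.

Lemma hg_sum (I : Type) (r : seq I) k (F : I -> tens C d) t :
  g k (fun s => \sum_(i <- r) F i s) t = \sum_(i <- r) g k (F i) t.
Proof. by rewrite /hg !mulr_sumr -big_split. Qed.

Lemma hg_scale k (c : C) x t : g k (fun s => c * x s) t = c * g k x t.
Proof. by rewrite /hg; ring. Qed.

(** [P] selects generators: [predT] all of them, positive indices those in the image of sigma. *)
Definition qeigen (m : nat) (P : pred nat) y : Prop :=
  forall k t, P k -> size t = m -> (k.+1 < m)%N -> g k y t = q * y t.

(** The product g_i ... g_1 of the recursion for A_m. *)
Fixpoint chain (i : nat) y : tens C d :=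
  if i is i'.+1 then g i' (chain i' y) else y.

Lemma chain_congr m i x y :
  (forall t, size t = m -> x t = y t) ->
  forall t, size t = m -> chain i x t = chain i y t.
Proof. by move=> xy; elim: i => //= i IH t ht; apply: hg_congr ht. Qed.

Lemma chain_scale i (c : C) x t :
  chain i (fun s => c * x s) t = c * chain i x t.
Proof.
elim: i t => //= i IH t; rewrite -hg_scale.
by apply: (hg_congr _ (m := size t)) => // s _; exact: IH.
Qed.

Lemma chain_sum (I : Type) (r : seq I) i (F : I -> tens C d) t :
  chain i (fun s => \sum_(j <- r) F j s) t = \sum_(j <- r) chain i (F j) t.
Proof.
elim: i t => //= i IH t; rewrite -hg_sum.
by apply: (hg_congr _ (m := size t)) => // s _; exact: IH.
Qed.

Lemma hg_chain_lt m i j y t : (i < j)%N -> (j.+1 < m)%N -> size t = m ->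
  g j (chain i y) t = chain i (g j y) t.
Proof.
elim: i t => //= i IH t ij jm ht; rewrite -hg_comm ?ht //.
by apply: hg_congr ht => s hs; apply: IH => //; apply: ltnW.
Qed.

(** The generator commutes with the upper factors until it meets its own copy; the braid relation
    there raises its index by one, and the raised generator commutes with the lower factors. *)
Lemma hg_chain_gt m i j y t : (j.+1 < i)%N -> (i < m)%N -> size t = m ->
  g j (chain i y) t = chain i (g j.+1 y) t.
Proof.
elim: i t => //= i IH t; rewrite ltnS leq_eqVlt => /predU1P[<-|ji] im ht /=.
  rewrite hg_braid ?ht //; apply: hg_congr ht => s hs.
  by apply: hg_congr hs => r hr; apply: (@hg_chain_lt m).
rewrite hg_comm ?ht //; apply: hg_congr ht => s hs.
by apply: IH => //; apply: ltnW.
Qed.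

(** For [i] other than [j] and [j.+1], [g j] passes through [chain i] and reaches [y] with a
    positive index, giving the factor q. The two remaining terms are exchanged up to the quadratic
    relation, since [chain j.+1] is [g j] applied to [chain j]; their sum is also multiplied by
    q. *)
Lemma sum_chain_qeigen m y :
  qeigen m.+1 (fun k => 0 < k)%N y ->
  qeigen m.+1 predT (fun t => \sum_(i <- iota 0 m.+1) chain i y t).
Proof.
move=> Hy j t _ ht jm; rewrite hg_sum -!/(index_iota 0 m.+1).
have lift i : (i < j)%N || (j.+1 < i)%N -> (i < m.+1)%N ->
    g j (chain i y) t = q * chain i y t.
  move=> ij im; rewrite -(chain_scale i q y).
  case/orP: ij => ij.
    rewrite (@hg_chain_lt m.+1) //; apply: chain_congr ht => s hs.
    by apply: Hy => //; apply: leq_ltn_trans ij.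
  rewrite (@hg_chain_gt m.+1) //; apply: chain_congr ht => s hs.
  by apply: Hy => //; apply: leq_ltn_trans im.
rewrite mulr_sumr !(big_cat_nat (n := j) (leq0n j) (ltnW (ltnW jm))) /=.
congr (_ + _).
  apply: eq_big_nat => i /andP[_ ij].
  by apply: lift; [rewrite ij | apply: ltn_trans ij (ltnW jm)].
rewrite !(big_ltn (ltnW jm)) !(big_ltn jm) addrA [RHS]addrA; congr (_ + _).
  have -> : g j (chain j.+1 y) t = (q - 1) * chain j.+1 y t + q * chain j y t.
    by apply: hg_hecke => //; rewrite ht.
  by rewrite -[g j [eta chain j y] t]/(chain j.+1 y t); ring.
apply: eq_big_nat => i /andP[ij im].
by apply: lift; rewrite // ij orbT.
Qed.

Definition gword w y : tens C d := foldr (fun a z => g a.-1 z) y w.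

Definition antisym k y : tens C d := fun t => \sum_(w <- Awords k) gword w y t.

Lemma gword_cat w w' y : gword (w ++ w') y = gword w (gword w' y).
Proof. exact: foldr_cat. Qed.

Lemma gword_chain i y : gword (rev (iota 1 i)) y = chain i y.
Proof.
elim: i => // i IH; rewrite -[X in iota _ X]addn1 iotaD rev_cat /=.
by rewrite IH.
Qed.

(** The shift sigma is the action on the tail with the first letter frozen. Letters must be positive
    because [gword] takes predecessors. *)
Lemma gword_shift w y a u : all (fun j => 0 < j)%N w ->
  gword (map S w) y (a :: u) = gword w (fun v => y (a :: v)) u.
Proof.
elim: w u => //= -[//|j] w IH u /= hw; rewrite hg_cons.
by apply: (hg_congr _ (m := size u)) => // v _; apply: IH.
Qed.

Lemma AwordsS k : Awords k.+1 =
  flatten [seq [seq rev (iota 1 i) ++ map S w | w <- Awords k]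
          | i <- iota 0 k.+2].
Proof. by []. Qed.

Lemma Awords_letters k w : w \in Awords k -> all (fun j => 0 < j <= k)%N w.
Proof.
elim: k w => [|k IH] w; first by rewrite inE => /eqP ->.
case/flatten_mapP => i; rewrite mem_iota => ik /mapP[w' /IH hw' ->].
rewrite all_cat all_rev; apply/andP; split.
  by apply/allP => j; rewrite mem_iota => /andP[-> h] /=; lia.
rewrite all_map; apply: sub_all hw' => j /=; lia.
Qed.

Lemma Awords_pos k w : w \in Awords k -> all (fun j => 0 < j)%N w.
Proof. by move/Awords_letters; apply: sub_all => j /andP[]. Qed.

(** The defining recursion of A_m, with sigma read as the action on tails. The value 0 at the empty
    sequence is never reached at length [k.+2]. *)
Lemma antisymS k y t : size t = k.+2 -> antisym k.+1 y t =
  \sum_(i <- iota 0 k.+2) chain i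
     (fun s => if s is a :: u then antisym k (fun v => y (a :: v)) u else 0) t.
Proof.
move=> ht; rewrite /antisym AwordsS big_flatten big_map.
apply: eq_bigr => i _; rewrite big_map.
rewrite (chain_congr _ (y := fun s => \sum_(w <- Awords k) gword (map S w) y s)
  (m := k.+2)) //.
  rewrite chain_sum.
  by apply: eq_bigr => w _; rewrite gword_cat gword_chain.
move=> [|a u] //= hu; apply: eq_big_seq => w hw.
by rewrite gword_shift // (Awords_pos hw).
Qed.

(** Induction on [k]: generators of positive index act on the tail, where the previous
    antisymmetrizer sits, and [sum_chain_qeigen] adds the first generator. *)
Lemma antisym_qeigen k y : qeigen k.+1 predT (antisym k y).
Proof.
elim: k y => [|k IH] y j t _ ht; first by case: j.
move=> hj; rewrite (hg_congr _ (antisymS y) ht) antisymS //.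
apply: (@sum_chain_qeigen k.+1) => //.
move=> {hj ht t}[//|j'] [|a u] // _ [hu] hj'.
rewrite hg_cons; exact: IH.
Qed.

Lemma gword_qeigen m w y t :
  qeigen m predT y -> size t = m -> all (fun j => 0 < j < m)%N w ->
  gword w y t = q ^+ size w * y t.
Proof.
move=> Hy; elim: w t => [|j w IH] t ht /=; first by rewrite mul1r.
case/andP => /andP[j0 jm] hw.
rewrite (hg_congr _ (m := m) (y := fun s => q ^+ size w * y s)) //.
  by rewrite hg_scale Hy ?prednK // exprSr mulrA.
by move=> s hs; apply: IH.
Qed.

(** The length of g_i ... g_1 sigma(w) is [i] plus that of [w], so the sum factors and the sum over
    [i] is the last factor of the q-factorial. *)
Lemma sum_q_Awords k : \sum_(w <- Awords k) q ^+ size w = qfact q k.+1.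
Proof.
elim: k => [|k IH].
  by rewrite big_seq1 /qfact big_nat1 big_ord1 !expr0.
rewrite AwordsS big_flatten big_map /qfact big_nat_recr // -/(qfact q k.+1) -IH [RHS]/=.
rewrite mulr_sumr -[iota 0 k.+2]/(index_iota 0 k.+2) big_mkord.
apply: eq_bigr => i _; rewrite big_map mulr_suml.
by apply: eq_bigr => w _; rewrite size_cat size_rev size_iota size_map exprD mulrC.
Qed.

Lemma antisym_id k y t : qeigen k.+1 predT y -> size t = k.+1 ->
  antisym k y t = qfact q k.+1 * y t.
Proof.
move=> Hy ht; rewrite -sum_q_Awords mulr_suml; apply: eq_big_seq => w hw.
by apply: (gword_qeigen (m := k.+1)) => //; exact: Awords_letters.
Qed.

(** Generators only mix values at rearrangements of the same word, so vanishing on a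
    permutation-invariant set of words is preserved. *)
Lemma gword_eq0 (P : pred (seq 'I_d)) w y t :
  (forall s s', perm_eq s s' -> P s = P s') ->
  (forall s, size s = size t -> P s -> y s = 0) -> P t -> gword w y t = 0.
Proof.
move=> HP; elim: w t => [|j w IH] t Hy Pt /=; first exact: Hy.
rewrite /hg !IH ?mulr0 ?addr0 //; first by move=> s; rewrite size_swp; exact: Hy.
by rewrite (HP _ t) // perm_swp.
Qed.

Hypothesis q1 : 1 + q != 0.
Hypothesis mu0 : mu != 0.

(* For [a < b] the eigenvalue equation reads [- mu * y (b, a) = q * y (a, b)]. *)
Lemma qeigen_swp m y k t : qeigen m predT y -> size t = m -> (k.+1 < m)%N ->
  y (swp k t) / (- mu) ^+ invs (swp k t) = y t / (- mu) ^+ invs t.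
Proof.
move=> Hy ht km.
(* Equal letters are fixed by the swap; a descent at [k] is an ascent of [swp k t]. *)
wlog lt : t ht / (at_ t k < at_ t k.+1)%N.
  move=> W; case: (ltngtP (at_ t k) (at_ t k.+1)) => h; first exact: W.
    by have := W (swp k t); rewrite swpK size_swp at_swp_l ?at_swp_r ?ht // => ->.
  by rewrite swp_fix ?ht.
have nmu0 : - mu != 0 by rewrite oppr_eq0.
rewrite invs_swp ?ht // exprS invfM mulrA; congr (_ / _).
have := Hy k t isT ht km; rewrite /hg /galpha /gbeta ltn_eqF // ltnNge (ltnW lt) /=.
rewrite mul0r addr0 => e; have -> : y (swp k t) = - mu * y t.
  by apply: (mulfI nmu0); rewrite e -mu2; ring.
by rewrite mulrAC divff // mul1r.
Qed.

Lemma qeigen_perm m y s t : qeigen m predT y -> size s = m -> perm_eq s t ->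
  y s / (- mu) ^+ invs s = y t / (- mu) ^+ invs t.
Proof.
move=> Hy; apply: (perm_swp_invariant (f := fun t => y t / (- mu) ^+ invs t)).
by move=> k u hu km; exact: (qeigen_swp Hy hu km).
Qed.

(** Rearrange two equal letters to the front: there the first generator acts as -1, so q y = - y and
    y vanishes. The permutation invariance carries this back to [t]. *)
Lemma qeigen_nuniq m y t : qeigen m predT y -> size t = m -> ~~ uniq t -> y t = 0.
Proof.
move=> Hy ht ut.
have [a [r hr]] : exists a r, perm_eq t [:: a, a & r].
  elim: t ut {ht} => //= b t IH; rewrite negb_and negbK => /orP[bt|/IH[a [r hr]]].
    by exists b, (rem b t); rewrite perm_cons perm_to_rem.
  exists a, (b :: r); apply: (perm_trans (y := b :: [:: a, a & r])).
    by rewrite perm_cons.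
  by apply/permPl; exact: (perm_catCA [:: b] [:: a; a] r).
have hm : size [:: a, a & r] = m by rewrite -(perm_size hr).
have y0 : y [:: a, a & r] = 0.
  have := Hy 0%N [:: a, a & r] isT hm; rewrite -{1}hm => /(_ isT).
  rewrite /hg /galpha /gbeta /at_ /= eqxx ltnn mul0r addr0 mulN1r => /eqP.
  rewrite eq_sym -subr_eq0 opprK -{2}[y _]mul1r -mulrDl addrC mulf_eq0 (negPf q1).
  by move/eqP.
apply/eqP; have := qeigen_perm Hy ht hr; rewrite y0 mul0r => /eqP.
by rewrite mulf_eq0 invr_eq0 expf_eq0 oppr_eq0 (negPf mu0) andbF orbF.
Qed.

End Antisymmetrizer.

(** * Sums over tuples *)

Section TupleSums.
Variables (V : nmodType) (T : finType).

Lemma sum_tuple_cons m (F : seq T -> V) :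
  \sum_(s : m.+1.-tuple T) F s = \sum_(a : T) \sum_(s : m.-tuple T) F (a :: s).
Proof.
rewrite pair_big_dep /=.
rewrite (reindex (fun p : T * m.-tuple T => [tuple of p.1 :: p.2])) //=.
exists (fun s : m.+1.-tuple T => (thead s, [tuple of behead s])).
  by case=> a s _; congr (_, _); apply: val_inj.
by move=> s _; rewrite /= -tuple_eta.
Qed.

Lemma sum_tuple_rcons m (F : seq T -> V) :
  \sum_(s : m.+1.-tuple T) F s = \sum_(a : T) \sum_(s : m.-tuple T) F (rcons s a).
Proof.
pose rv k (s : k.-tuple T) := [tuple of rev s].
have rvK k : involutive (@rv k) by move=> s; apply: val_inj; rewrite /= revK.
rewrite (reindex_inj (inv_inj (@rvK m.+1))) /=.
rewrite (sum_tuple_cons m (fun s => F (rev s))); apply: eq_bigr => a _.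
rewrite (reindex_inj (inv_inj (@rvK m))) /=.
by apply: eq_bigr => s _; rewrite rev_cons revK.
Qed.

Lemma sum_tuple_eq m (u : seq T) (F : seq T -> V) : size u = m ->
  \sum_(s : m.-tuple T) (if s == u :> seq T then F s else 0) = F u.
Proof.
move=> hu; have hs : size u == m by apply/eqP.
rewrite (bigD1 (Tuple hs)) //= eqxx big1 ?addr0 // => s.
by rewrite -val_eqE /= => /negPf ->.
Qed.

End TupleSums.

(** * Agreement of the matrix representation with the coordinate operators *)

Section EpsilonGenerators.
Variables (C : numClosedFieldType) (d : nat) (q mu : C).
Implicit Types (x : tens C d) (t u : seq 'I_d).

Lemma gcoefE a b c e : gcoef q mu a b c e =
  (if (c == b) && (e == a) then galpha mu a b else 0)
  + (if (c == a) && (e == b) then gbeta q a b else 0).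
Proof.
rewrite /gcoef /galpha /gbeta (eq_sym e a) (eq_sym c b) (eq_sym c a) (eq_sym e b).
case: (ltngtP c e) => ce; case: (ltngtP a b) => ab;
  case: (eqVneq a e) => ae; case: (eqVneq b c) => bc;
  case: (eqVneq a c) => ac; case: (eqVneq b e) => be;
  rewrite /= ?addr0 ?add0r //; exfalso; lia.
Qed.

Lemma at_inj m t u : size t = m -> size u = m ->
  (forall k, (k < m)%N -> at_ t k = at_ u k) -> t = u.
Proof.
move=> ht hu tu; apply: (inj_map (@ord_inj d)).
apply: (eq_from_nth (x0 := 0%N)).
  by rewrite !size_map ht hu.
by move=> k; rewrite size_map ht => /tu.
Qed.

Lemma at_swp_neq k j t : j != k -> j != k.+1 -> at_ (swp k t) j = at_ t j.
Proof.
elim: k j t => [|k IH] [|j] [|a t] //=; first by case: t j => [|b t] [|[|j]].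
by rewrite !eqSS => jk jk1; exact: IH.
Qed.

Lemma eps_g_hg m k x t : size t = m -> (k.+1 < m)%N ->
  eps_g q mu m k.+1 x t = hg q mu k x t.
Proof.
move=> ht km; rewrite /eps_g /=.
set a := at_ t k; set b := at_ t k.+1.
have hk : (k < m)%N by apply: ltnW.
(* Both terms of [hg] become sums over all [s] with an indicator, so that the two sides can be
   compared term by term. *)
rewrite /hg -/a -/b -(sum_tuple_eq (fun s => galpha mu a b * x s) (m := m)
   (u := swp k t)) ?size_swp //.
rewrite -(sum_tuple_eq (fun s => gbeta q a b * x s) ht) -big_split /=.
apply: eq_bigr => s _.
have hs : size s = m by rewrite size_tuple.
set P := [forall _, _].
(* Agreement with [t] off the two active positions, together with the two prescribed entries,
   determines [s]. *)
have E c e (u : seq 'I_d) : size u = m -> at_ u k = c -> at_ u k.+1 = e ->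
    (forall j, j != k -> j != k.+1 -> at_ u j = at_ t j) ->
    P && ((at_ s k == c) && (at_ s k.+1 == e)) = (s == u :> seq 'I_d).
  move=> hu uc ue uj; apply/andP/eqP => [[/forallP Ps /andP[/eqP sc /eqP se]]|su].
    apply: (@at_inj m) => // j jm.
    have [->|jk] := eqVneq j k; first by rewrite sc uc.
    have [->|jk1] := eqVneq j k.+1; first by rewrite se ue.
    have /implyP := Ps (Ordinal jm); rewrite /= jk jk1 => /(_ isT)/eqP <-.
    by rewrite uj.
  rewrite su uc ue !eqxx; split=> //; apply/forallP => j; apply/implyP.
  by case/andP => jk jk1; rewrite su uj.
have kt : (k.+1 < size t)%N by rewrite ht.
rewrite -(E b a _ (etrans (size_swp k t) ht) (at_swp_l kt) (at_swp_r kt));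
  last by move=> j; exact: at_swp_neq.
rewrite -(E a b t) // gcoefE mulrDl.
case: (P) => /=; last by rewrite addr0.
by do 2!case: ifP => _; rewrite ?mul0r.
Qed.

Lemma word_op_gword m w x t : size t = m -> all (fun j => 0 < j < m)%N w ->
  word_op q mu m w x t = gword q mu w x t.
Proof.
elim: w t => //= j w IH t ht /andP[/andP[j0 jm] hw].
rewrite -{1}(prednK j0) eps_g_hg ?prednK //.
by apply: (@hg_congr _ _ q mu m) => // s hs; apply: IH.
Qed.

Lemma epsE_antisym k x t : size t = k.+1 ->
  epsE q mu k.+1 x t = (qfact q k.+1)^-1 * antisym q mu k x t.
Proof.
move=> ht; rewrite /epsE; congr (_ * _); apply: eq_big_seq => w hw.
by rewrite word_op_gword //; exact: Awords_letters.
Qed.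

End EpsilonGenerators.

(** * The q-factorial as generating function of inversions *)

Section QuantumFactorial.
Variables (C : numClosedFieldType) (d : nat) (q : C).
Implicit Types L : seq 'I_d.

(** The exponents are the ranks 0, 1, ... of the letters: after sorting, the head has rank 0 and
    raises every other rank by one. *)
Lemma sum_q_rank L : uniq L ->
  \sum_(a <- L) q ^+ count (fun b : 'I_d => (b < a)%N) L = \sum_(k < size L) q ^+ k.
Proof.
move=> uL; pose le (a b : 'I_d) := (a <= b)%N.
have le_tot : total le by move=> a b; apply: leq_total.
have le_tr : transitive le by move=> a b c; apply: leq_trans.
have pL : perm_eq (sort le L) L by rewrite perm_sort.
rewrite -(perm_big _ pL) /= -(perm_size pL).
rewrite (eq_bigr (fun a : 'I_d => q ^+ count (fun b : 'I_d => (b < a)%N) (sort le L)));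
  last by move=> a _; rewrite (seq.permP pL).
have := sort_sorted le_tot L; have : uniq (sort le L) by rewrite sort_uniq.
elim: (sort le L) => [|a s IH] /=; first by rewrite big_nil big_ord0.
case/andP => as_ us ps.
have gt b : b \in s -> (a < b)%N.
  move=> bs; rewrite ltn_neqAle -/(le a b) (allP (order_path_min le_tr ps) b bs) andbT.
  by apply: contraNneq as_ => /val_inj ->.
rewrite big_cons ltnn add0n big_ord_recl /=; congr (_ + _).
  rewrite -(count_pred0 s); congr (_ ^+ _); apply: eq_in_count => b /gt ab /=.
  by rewrite ltnNge (ltnW ab).
rewrite (eq_bigr (fun k : 'I_(size s) => q * q ^+ k)); last first.
  by move=> k _; rewrite -exprS.
rewrite -mulr_sumr -IH // ?(path_sorted ps) // mulr_sumr.
by apply: eq_big_seq => b /gt ->; rewrite exprS.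
Qed.

(** Split by the first letter [a]: it contributes its rank in [L], and the tail runs over the
    rearrangements of [rem a L]. *)
Lemma sum_q_invs m L : uniq L -> size L = m ->
  \sum_(s : m.-tuple 'I_d | perm_eq s L) q ^+ invs s = qfact q m.
Proof.
elim: m L => [|m IH] L uL hL.
  rewrite (size0nil hL) /qfact big_geq // (big_pred1 [tuple]) //.
  by move=> s; rewrite tuple0 /= eqxx.
rewrite big_mkcond (sum_tuple_cons m
  (fun s => if perm_eq s L then q ^+ invs s else 0)).
rewrite /qfact big_nat_recr //= -/(qfact q m) -hL -sum_q_rank // mulr_sumr.
rewrite [RHS]big_uniq //= big_mkcond [RHS]big_mkcond.
apply: eq_bigr => a _; have [aL|aL] := boolP (a \in L); last first.
  apply: big1 => s _; case: ifP => // /perm_mem/(_ a).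
  by rewrite inE eqxx (negPf aL).
have pL := perm_to_rem aL.
rewrite -(IH (rem a L)) ?rem_uniq ?size_rem ?hL // -big_mkcond mulr_suml.
rewrite (eq_bigl (fun s : m.-tuple 'I_d => perm_eq s (rem a L))); last first.
  by move=> s; rewrite (permPr pL) perm_cons.
apply: eq_bigr => s ps; rewrite mulrC -exprD /=; congr (_ ^+ (_ + _)).
by rewrite (seq.permP pL) /= ltnn (seq.permP ps).
Qed.

End QuantumFactorial.

(** * Coordinates of S *)

Section SVector.
Variables (C : numClosedFieldType) (d n : nat) (mu : C) (i : 'I_n -> 'I_d).
Hypothesis i_incr : forall a b : 'I_n, (a < b)%N -> (i a < i b)%N.

Lemma ltn_incr a b : (i a < i b)%N = (a < b)%N.
Proof.
case: (ltngtP a b) => [/i_incr -> //|/i_incr ba|/val_inj ->]; last by rewrite ltnn.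
by rewrite ltnNge (ltnW ba).
Qed.

Lemma incr_inj : injective i.
Proof.
move=> a b e; apply: val_inj; case: (ltngtP a b) => // /i_incr; by rewrite e ltnn.
Qed.

Lemma uniq_codom : uniq (codom i).
Proof. by rewrite map_inj_uniq ?enum_uniq //; exact: incr_inj. Qed.

Lemma invs_enum m (f : 'I_m -> 'I_d) : invs [seq f k | k <- enum 'I_m] =
  (\sum_(a < m) \sum_(b < m) ((a < b)%N && (f b < f a)%N))%N.
Proof.
elim: m f => [|m IH] f; first by rewrite big_ord0 enum_ord0.
rewrite enum_ordSl /= -map_comp (IH (f \o lift ord0)) big_ord_recl; congr (_ + _)%N.
  rewrite big_ord_recl /= add0n count_map -sum1_count big_enum_cond /=.
  by rewrite big_mkcond /=; apply: eq_bigr => b _; case: ifP.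
by apply: eq_bigr => a _; rewrite big_ord_recl /=.
Qed.

Lemma invs_perm (p : 'S_n) : invs [seq i (p k) | k <- enum 'I_n] = inversions p.
Proof.
rewrite (invs_enum (fun k => i (p k))) /inversions -sum1dep_card pair_big_dep /=.
by rewrite [RHS]big_mkcond /=; apply: eq_bigr => -[a b] _ /=; rewrite ltn_incr; case: ifP.
Qed.

(** As [i] is injective, at most one permutation yields [t]; as [i] is increasing, its inversions
    are those of the word [t]. *)
Lemma SvecE t : Svec mu i t = if perm_eq t (codom i) then (- mu) ^+ invs t else 0.
Proof.
rewrite /Svec; case: ifP => [|nt].
  have -> : codom i = [tuple i k | k < n] by [].
  case/tuple_permP => p tp.
  have {}tp : t = [seq i (p k) | k <- enum 'I_n].
    by rewrite tp /=; apply: eq_map => k; rewrite tnth_mktuple.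
  rewrite (bigD1 p) //= tp eqxx mulr1 invs_perm big1 ?addr0 // => p' pp'.
  case: eqP => [e|]; last by rewrite mulr0.
  case/eqP: pp'; apply/permP => k; apply: incr_inj.
  by move/eq_in_map: e => /(_ k) ->; rewrite // mem_enum.
apply: big1 => p _; case: eqP => [e|]; last by rewrite mulr0.
case/negP: nt; rewrite e; apply/(@tuple_permP _ _ _ [tuple i k | k < n]).
by exists p; rewrite /=; apply: eq_map => k; rewrite tnth_mktuple.
Qed.

(** The letters are distinct, so a swap changes the inversion number by exactly one, up at an ascent
    and down at a descent. *)
Lemma Svec_qeigen : qeigen (mu ^+ 2) mu n predT (Svec (d := d) mu i).
Proof.
move=> k t _ ht km; rewrite /hg !SvecE (permPl (perm_swp k t)).
case: ifP => pt; last by rewrite !mulr0 addr0.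
have ut : uniq t by rewrite (perm_uniq pt) uniq_codom.
have := at_uniq (k := k) _ ut; rewrite ht => /(_ km).
rewrite /galpha /gbeta; case: (ltngtP (at_ t k) (at_ t k.+1)) => // lt _.
  by rewrite invs_swp ?ht // !exprS; ring.
have -> : invs t = (invs (swp k t)).+1.
  by rewrite -{1}[t](swpK k) invs_swp ?size_swp ?at_swp_l ?at_swp_r ?ht.
by rewrite !exprS; ring.
Qed.

End SVector.

(** * Membership of R and its companion, and the conjugate equations *)

Lemma perm_cons_head (T : eqType) (a b : T) s : perm_eq (a :: s) (b :: s) -> a = b.
Proof.
by move/seq.permP/(_ (pred1 b)) => /=; rewrite eqxx => /addIn; case: eqP.
Qed.

Section Conjugates.
Variables (C : numClosedFieldType) (q : C) (d k : nat) (i : 'I_k.+2 -> 'I_d).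
Hypothesis q_gt0 : 0 < q.
Hypothesis i_incr : forall a b : 'I_k.+2, (a < b)%N -> (i a < i b)%N.

Let mu : C := sqrtC q.
(** The normalizing factor of R, with n = k + 2. *)
Let c : C := (sqrtC mu ^+ k.+1 * sqrtC (qfact q k.+1))^-1.
Notation S := (Svec (d := d) mu i).

Lemma qfact_gt0 m : 0 < qfact q m.
Proof.
rewrite /qfact big_nat_cond; apply: prodr_gt0 => j; rewrite andbT => /andP[j0 _].
rewrite -(prednK j0) big_ord_recl expr0; apply: ltr_wpDr => //.
by apply: sumr_ge0 => l _; rewrite exprn_ge0 // ltW.
Qed.

Lemma mu_gt0 : 0 < mu.
Proof. by rewrite sqrtC_gt0. Qed.

Lemma mu_neq0 : mu != 0.
Proof. by rewrite gt_eqF ?mu_gt0. Qed.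

Lemma onePq_neq0 : 1 + q != 0.
Proof. by rewrite gt_eqF // addr_gt0. Qed.

Lemma mu_sqr : mu ^+ 2 = q.
Proof. exact: sqrtCK. Qed.

Lemma c_gt0 : 0 < c.
Proof.
by rewrite invr_gt0 mulr_gt0 ?exprn_gt0 ?sqrtC_gt0 ?qfact_gt0 // mu_gt0.
Qed.

Lemma c_norm : c * c * (mu ^+ k.+1 * qfact q k.+1) = 1.
Proof.
have e : c^-1 * c^-1 = mu ^+ k.+1 * qfact q k.+1.
  by rewrite /c invrK mulrACA -exprMn -!expr2 !sqrtCK.
by rewrite -e mulrACA !mulfV ?mul1r // gt_eqF // c_gt0.
Qed.

(** Removes the complex conjugation that the adjoint introduces in [contr]. *)
Lemma S_real t : (c * S t)^* = c * S t.
Proof.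
apply/CrealP/rpredM; first by rewrite gtr0_real // c_gt0.
rewrite SvecE //; case: ifP => _; last exact: rpred0.
by rewrite rpredX // rpredN gtr0_real // mu_gt0.
Qed.

(** E_(n-1) fixes such an [x], so [x] serves as its own preimage. *)
Lemma qeigen_in_Hbar x : qeigen q mu k.+1 predT x ->
  in_Hi_pow i k.+1 x -> in_Hbar q mu i x.
Proof.
move=> qx hx; exists x; split=> // t; rewrite epsE_antisym ?size_tuple //.
by rewrite (antisym_id qx) ?size_tuple // mulKf // gt_eqF // qfact_gt0.
Qed.

Lemma in_Hbar_qeigen x : in_Hbar q mu i x -> qeigen q mu k.+1 predT x.
Proof.
case=> y [_ xy] l t _ ht lk.
have {}xy s : size s = k.+1 -> x s = (qfact q k.+1)^-1 * antisym q mu k y s.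
  move=> hs; rewrite -epsE_antisym //.
  by have := xy (Tuple (introT eqP hs)).
rewrite (hg_congr q mu l xy ht) xy // hg_scale.
by rewrite (antisym_qeigen mu_sqr) //; ring.
Qed.

Lemma in_Hbar_supp x t : in_Hbar q mu i x -> size t = k.+1 ->
  ~~ all (fun a => a \in codom i) t -> x t = 0.
Proof.
case=> y [hy xy] ht nt.
have /= -> := xy (Tuple (introT eqP ht)).
rewrite epsE_antisym // /antisym big1 ?mulr0 // => w _.
apply: (@gword_eq0 _ _ _ _ (fun s => ~~ all (fun a => a \in codom i) s)) => //.
  by move=> s s' ss'; rewrite (perm_all _ ss').
move=> s; rewrite ht => hs; have := hy (Tuple (introT eqP hs)); rewrite /=.
by case: eqP => // _ ->.
Qed.

Lemma Svec_supp t : S t != 0 -> {subset t <= codom i}.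
Proof.
by rewrite SvecE //; case: ifP => [/perm_mem pt _ a|]; rewrite ?eqxx // pt.
Qed.

(** The generators concerned do not touch the last letter, so the eigenvalue equations of S survive
    freezing it. *)
Lemma rcons_S_in_Hbar (e : C) b :
  in_Hbar q mu i (fun u => e * S (rcons u b)).
Proof.
apply: qeigen_in_Hbar => [l t _ ht lk|t].
  rewrite hg_scale mulrCA; congr (_ * _).
  have := Svec_qeigen mu i_incr (k := l) (t := rcons t b) isT.
  rewrite size_rcons ht mu_sqr => /(_ erefl (ltnW lk)) <-.
  by rewrite /hg -!cats1 swp_cat ?ht // !at_cat ?ht // ltnW.
rewrite mulf_eq0 negb_or => /andP[_ /Svec_supp H].
by apply/allP => a ta; apply: H; rewrite mem_rcons inE ta orbT.
Qed.

Lemma cons_S_in_Hbar (e : C) b : in_Hbar q mu i (fun u => e * S (b :: u)).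
Proof.
apply: qeigen_in_Hbar => [l t _ ht lk|t].
  rewrite hg_scale mulrCA; congr (_ * _).
  have := Svec_qeigen mu i_incr (k := l.+1) (t := b :: t) isT.
  by rewrite mu_sqr /= ht; apply.
rewrite mulf_eq0 negb_or => /andP[_ /Svec_supp H].
by apply/allP => a ta; apply: H; rewrite inE ta orbT.
Qed.

(** Each letter of [s] forms an inversion with [b] in exactly one of the two placements of [b]. *)
Lemma invs_cons_rcons (s : seq 'I_d) b : b \notin s ->
  (invs (b :: s) + invs (rcons s b) = 2 * invs s + size s)%N.
Proof. by move=> bs; rewrite invs_rcons -(count_lt_gt bs) /=; lia. Qed.

Definition basis_vec (a : 'I_d) : tens C d := fun u => (u == [:: a])%:R.

Lemma basis_vec_in_Hi (j : 'I_k.+2) : in_Hi_pow i 1 (basis_vec (i j)).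
Proof.
move=> t; rewrite /basis_vec; case: (tval t =P [:: i j]) => [->|_].
  by rewrite /= codom_f.
by rewrite eqxx.
Qed.

Lemma R_in_Hbar_Hi :
  in_tens k.+1 1 (in_Hbar q mu i) (in_Hi_pow i 1) (fun t => c * S t).
Proof.
(* Expansion of R along its last tensor factor; a last letter outside the image of [i] makes both
   sides vanish. *)
exists k.+2, (fun j u => c * S (rcons u (i j))), (fun j => basis_vec (i j)).
split; first by move=> j; exact: rcons_S_in_Hbar.
split; first exact: basis_vec_in_Hi.
move=> t; have : size t == k.+2 by rewrite size_tuple addn1.
case/lastP: (tval t) => [//|s b]; rewrite size_rcons eqSS => /eqP hs.
have take_s : take k.+1 (rcons s b) = s by rewrite -cats1 take_size_cat.
have drop_s : drop k.+1 (rcons s b) = [:: b] by rewrite -cats1 drop_size_cat.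
rewrite /tprod take_s drop_s /basis_vec.
have [/codomP[j ->]|nb] := boolP (b \in codom i).
  rewrite (bigD1 j) //= eqxx mulr1 big1 ?addr0 // => l lj.
  rewrite eqseq_cons andbT (inj_eq (incr_inj i_incr)) eq_sym (negPf lj).
  by rewrite mulr0.
rewrite big1 => [|l _].
  rewrite SvecE //; case: ifP => [/perm_mem/(_ b)|]; rewrite ?mulr0 //.
  by rewrite mem_rcons inE eqxx (negPf nb).
by case: eqP => [[e]|]; rewrite ?mulr0 //; rewrite e codom_f in nb.
Qed.

Lemma Rbar_in_Hi_Hbar :
  in_tens 1 k.+1 (in_Hi_pow i 1) (in_Hbar q mu i)
    (fun t => (-1) ^+ k.+1 * (c * S t)).
Proof.
exists k.+2, (fun j => basis_vec (i j)),
  (fun j u => ((-1) ^+ k.+1 * c) * S (i j :: u)).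
split; first exact: basis_vec_in_Hi.
split; first by move=> j; exact: cons_S_in_Hbar.
move=> t; have : size t == k.+2 by rewrite size_tuple.
case: (tval t) => [//|b s]; rewrite eqSS => /eqP hs.
rewrite /tprod /= take0 drop0 /basis_vec.
have [/codomP[j ->]|nb] := boolP (b \in codom i).
  rewrite (bigD1 j) //= eqxx mul1r mulrA big1 ?addr0 // => l lj.
  rewrite eqseq_cons andbT (inj_eq (incr_inj i_incr)) eq_sym (negPf lj).
  by rewrite mul0r.
rewrite big1 => [|l _].
  rewrite SvecE //; case: ifP => [/perm_mem/(_ b)|]; rewrite ?mulr0 //.
  by rewrite inE eqxx (negPf nb).
by case: eqP => [[e]|]; rewrite ?mul0r //; rewrite e codom_f in nb.
Qed.

Lemma conj_sign : ((-1) ^+ k.+1 : C)^* = (-1) ^+ k.+1.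
Proof. by rewrite rmorphXn rmorphN1. Qed.

(** The exponents add up to 2 inv s + (n - 1); the sign in [Rbar] cancels that of (- mu)^(n-1). *)
Lemma sign_mu_invs (s : seq 'I_d) b : b \notin s -> size s = k.+1 ->
  (-1) ^+ k.+1 * ((- mu) ^+ invs (b :: s) * (- mu) ^+ invs (rcons s b))
  = mu ^+ k.+1 * q ^+ invs s.
Proof.
move=> bs hs; rewrite -exprD invs_cons_rcons // hs exprD exprM sqrrN mu_sqr.
by rewrite mulrCA -exprMn mulN1r opprK mulrC.
Qed.

Lemma perm_rem_codom b (s : seq 'I_d) : b \in codom i ->
  perm_eq (b :: s) (codom i) = perm_eq s (rem b (codom i)).
Proof. by move=> bi; rewrite (permPr (perm_to_rem bi)) perm_cons. Qed.

Lemma conjugate_eq1 (v : tens C d) : in_Hi_pow i 1 v ->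
  teq 1 (contr k.+2 (fun t => (-1) ^+ k.+1 * (c * S t))
           (tprod 1 v (fun t => c * S t))) v.
Proof.
move=> hv t; case/tupleP: t => b t; rewrite tuple0 /contr /=.
rewrite (sum_tuple_cons k.+1 (fun s => ((-1) ^+ k.+1 * (c * S s))^* *
  tprod 1 v (fun t => c * S t) (s ++ [:: b]))).
(* A nonzero term needs both [a :: s] and [rcons s b] to be rearrangements of [codom i], hence
   [a = b]. *)
rewrite (bigD1 b) //= [X in _ + X]big1 ?addr0; last first.
  move=> a ab; apply: big1 => s _; rewrite /tprod /= drop0 cats1 !SvecE //.
  case: ifP => p1; last by rewrite !mulr0 rmorph0 mul0r.
  case: ifP => p2; last by rewrite !mulr0.
  case/eqP: ab; apply: (@perm_cons_head _ _ _ s).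
  by rewrite (permPl p1) -(permPl p2) perm_rcons.
have [bi|nb] := boolP (b \in codom i); last first.
  have v0 : v [:: b] = 0.
    by apply: contraNeq nb => /(hv [tuple b]); rewrite /= andbT.
  by rewrite v0 big1 // => s _; rewrite /tprod /= take0 v0 mul0r mulr0.
rewrite (eq_bigr (fun s : k.+1.-tuple 'I_d => v [:: b] * (c * c * mu ^+ k.+1) *
    (if perm_eq s (rem b (codom i)) then q ^+ invs s else 0))); last first.
  move=> s _; rewrite /tprod /= take0 drop0 cats1 rmorphM /= conj_sign S_real !SvecE //.
  rewrite perm_rcons perm_rem_codom //; case: ifP => ps; last by rewrite !mulr0.
  have bs : b \notin s.
    by rewrite (perm_mem ps) mem_rem_uniqF // uniq_codom.
  have e := sign_mu_invs bs (size_tuple s).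
  transitivity (v [:: b] * (c * c) *
    ((-1) ^+ k.+1 * ((- mu) ^+ invs (b :: s) * (- mu) ^+ invs (rcons s b)))).
    by ring.
  by rewrite e; ring.
rewrite -mulr_sumr -big_mkcond sum_q_invs ?rem_uniq ?uniq_codom //; last first.
  by rewrite size_rem // size_codom card_ord.
by rewrite -!mulrA [c * (c * _)]mulrA c_norm mulr1.
Qed.

Lemma conjugate_eq2 (x : tens C d) : in_Hbar q mu i x ->
  teq k.+1 (contr k.+2 (fun t => c * S t)
     (tprod k.+1 x (fun t => (-1) ^+ k.+1 * (c * S t)))) x.
Proof.
move=> hx u; have hu := size_tuple u; rewrite /contr.
(* [x] takes the first n - 1 contracted letters; the last one, [b], becomes the first letter of
   [Rbar], followed by [u]. *)
rewrite (sum_tuple_rcons k.+1 (fun s => (c * S s)^* *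
  tprod k.+1 x (fun t => (-1) ^+ k.+1 * (c * S t)) (s ++ u))).
have term b (s : k.+1.-tuple 'I_d) : (c * S (rcons s b))^* *
    tprod k.+1 x (fun t => (-1) ^+ k.+1 * (c * S t)) (rcons s b ++ u) =
    c * c * (S (rcons s b) * x s * ((-1) ^+ k.+1 * S (b :: u))).
  rewrite S_real /tprod cat_rcons take_size_cat ?size_tuple //.
  by rewrite drop_size_cat ?size_tuple //; ring.
have [au|nau] := boolP (all (fun a => a \in codom i) u); last first.
  rewrite (in_Hbar_supp hx) // big1 // => b _; apply: big1 => s _.
  rewrite term [S (b :: u)]SvecE //; case: ifP => [pu|]; last by rewrite !mulr0.
  case/negP: nau; apply/allP => a ua.
  by rewrite -(perm_mem pu) inE ua orbT.
have qx := in_Hbar_qeigen hx.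
have [uu|nuu] := boolP (uniq u); last first.
  rewrite (qeigen_nuniq mu_sqr onePq_neq0 mu_neq0 qx hu nuu).
  rewrite big1 // => b _; apply: big1 => s _.
  rewrite term [S (b :: u)]SvecE //; case: ifP => [pu|]; last by rewrite !mulr0.
  by move: (perm_uniq pu); rewrite uniq_codom //= (negPf nuu) andbF.
(* The n - 1 distinct letters of [u] miss some letter [b] of the n-element image, and by cardinality
   [b :: u] exhausts it. *)
have [b bi bu] : exists2 b, b \in codom i & b \notin u.
  apply/hasP; rewrite has_predC; apply/negP => /allP ui.
  have := uniq_leq_size (uniq_codom i_incr) ui.
  by rewrite size_codom card_ord hu ltnn.
have pbu : perm_eq (b :: u) (codom i).
  have ubu : uniq (b :: u) by rewrite /= bu.
  apply: uniq_perm => //; first exact: uniq_codom.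
  have sub : {subset b :: u <= codom i}.
    by move=> a; rewrite inE => /predU1P[-> //|]; exact: (allP au).
  by case: (uniq_min_size ubu sub); rewrite //= size_codom card_ord hu.
rewrite (bigD1 b) //= [X in _ + X]big1 ?addr0; last first.
  move=> a ab; apply: big1 => s _; rewrite term [S (a :: u)]SvecE //.
  case: ifP => pau; last by rewrite !mulr0.
  by case/eqP: ab; apply: (@perm_cons_head _ _ _ u); rewrite (permPl pau) perm_sym.
rewrite (eq_bigr (fun s : k.+1.-tuple 'I_d => x u * (c * c * mu ^+ k.+1) *
    (if perm_eq s u then q ^+ invs s else 0))); last first.
  move=> s _; rewrite term !SvecE // pbu perm_rcons -(permPr pbu) perm_cons.
  case: ifP => su; last by rewrite !mul0r !mulr0.
  have bs : b \notin s by rewrite (perm_mem su).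
  have e := sign_mu_invs bs (size_tuple s).
  have nz m : (- mu) ^+ m != 0 by rewrite expf_neq0 // oppr_eq0 mu_neq0.
  have xs : x s = x u / (- mu) ^+ invs u * (- mu) ^+ invs s.
    by rewrite -(qeigen_perm mu_sqr mu_neq0 qx (size_tuple s) su) divfK.
  (* A leading [b] adds the same number of inversions to [u] and to its rearrangement [s]. *)
  have eu : (- mu) ^+ invs (b :: u) * (- mu) ^+ invs s
      = (- mu) ^+ invs (b :: s) * (- mu) ^+ invs u.
    by rewrite -!exprD /= (seq.permP su) addnAC.
  transitivity (c * c * (x u / (- mu) ^+ invs u) * ((-1) ^+ k.+1 *
    ((- mu) ^+ invs (b :: u) * (- mu) ^+ invs s * (- mu) ^+ invs (rcons s b)))).
    by rewrite xs; ring.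
  rewrite eu; transitivity (c * c * (x u / (- mu) ^+ invs u * (- mu) ^+ invs u) *
    ((-1) ^+ k.+1 * ((- mu) ^+ invs (b :: s) * (- mu) ^+ invs (rcons s b)))).
    by ring.
  by rewrite divfK // e; ring.
rewrite -mulr_sumr -big_mkcond sum_q_invs //.
by rewrite -!mulrA [c * (c * _)]mulrA c_norm mulr1.
Qed.

End Conjugates.

Theorem theorem5p5 (C : numClosedFieldType) (q : C) (d n : nat)
    (i : 'I_n -> 'I_d) :
  0 < q -> (2 <= n)%N -> (n <= d)%N ->
  (forall a b : 'I_n, (a < b)%N -> (i a < i b)%N) ->
  let mu := sqrtC q in
  let R : tens C d := fun t =>
    (sqrtC mu ^+ n.-1 * sqrtC (qfact q n.-1))^-1 * Svec mu i t in
  let Rbar : tens C d := fun t => (-1) ^+ n.-1 * R t in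
  let Hi := in_Hi_pow i 1 in
  let Hbar := in_Hbar q mu i in
  [/\ in_tens n.-1 1 Hbar Hi R,
      in_tens 1 n.-1 Hi Hbar Rbar,
      (forall v : tens C d, Hi v -> teq 1 (contr n Rbar (tprod 1 v R)) v) &
      (forall x : tens C d, Hbar x -> teq n.-1 (contr n R (tprod n.-1 x Rbar)) x)].
Proof.
case: n i => [|[|k]] // i q_gt0 _ _ i_incr mu R Rbar Hi Hbar; split.
- exact: R_in_Hbar_Hi.
- exact: Rbar_in_Hi_Hbar.
- exact: conjugate_eq1.
- exact: conjugate_eq2.
Qed.
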